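(* $\tilde t(2)=\frac{46}{17}$.
   Context: Let $\mathfrak{C}=\{0,1\}^n$ be the vertex set of the $n$-dimensional hypercube; $\oplus,\wedge$ denote bitwise XOR and AND. An outmap is any function $s:\mathfrak{C}\to\{0,1\}^n$. A clash of $s$ is a pair of distinct vertices $u,v$ with $(s(u)\oplus s(v))\wedge(u\oplus v)=0^n$. A query at $u$ to the oracle for $s$ returns $s(u)$; algorithms choose queries adaptively, and only the number of queries is counted. \textsc{Sink-or-Clash}: given oracle access to an arbitrary outmap $s$, query either a vertex $u$ with $s(u)=0^n$ or both vertices of some clash. $\tilde t(n)=\min_{\mathcal A}\max_s \mathbb E[\tilde t(\mathcal A,s)]$, where $\mathcal A$ ranges over randomized algorithms solving \textsc{Sink-or-Clash} on all outmaps $s$ of the $n$-cube and $\tilde t(\mathcal A,s)$ is the random number of queries made on $s$. *)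

(* Defs.v *)
From mathcomp Require Import all_boot all_order all_algebra.
From mathcomp Require Import all_classical all_reals all_analysis.

Set Implicit Arguments.
Unset Strict Implicit.
Unset Printing Implicit Defensive.

Import Order.TTheory GRing.Theory Num.Theory.
Local Open Scope classical_set_scope.
Local Open Scope ring_scope.

(* Used both for the vertices of the n-cube and for the values of an outmap. *)
Notation bits n := {ffun 'I_n -> bool}.

Definition bits0 n : bits n := [ffun => false].
Definition bits_xor n (u v : bits n) : bits n := [ffun i => u i (+) v i].
Definition bits_and n (u v : bits n) : bits n := [ffun i => u i && v i].

Notation outmap n := {ffun bits n -> bits n}.

Definition clash n (s : outmap n) (u v : bits n) : Prop :=
  u <> v /\ bits_and (bits_xor (s u) (s v)) (bits_xor u v) = bits0 n.

(* The (vertex, oracle answer) pairs seen so far, oldest first. *)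
Definition history (n : nat) : Type := seq (bits n * bits n).

(* Given the history, an adaptive deterministic algorithm either makes one more
   query ([Some u]) or halts ([None]). *)
Definition det_alg (n : nat) : Type := history n -> option (bits n).

(* The history on [s] after [k] steps; it is stationary once [a] has halted.
   Every query is recorded, including repeated ones. *)
Fixpoint run n (a : det_alg n) (s : outmap n) (k : nat) : history n :=
  if k is k'.+1 then
    let h := run a s k' in
    if a h is Some u then rcons h (u, s u) else h
  else [::].

Definition queried n (h : history n) (u : bits n) : Prop := u \in map fst h.

Definition sink_or_clash n (s : outmap n) (h : history n) : Prop :=
  (exists2 u, queried h u & s u = bits0 n) \/
  (exists u v, [/\ queried h u, queried h v & clash s u v]).

Definition det_solves_on n (a : det_alg n) (s : outmap n) : Prop :=
  exists k, a (run a s k) = None /\ sink_or_clash s (run a s k).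

(* Equal to +oo if [a] never halts on [s]. *)
Definition queries (R : realType) n (a : det_alg n) (s : outmap n) : \bar R :=
  ereal_sup [set ((size (run a s k))%:R)%:E | k in [set: nat]].

(* A randomized algorithm draws a deterministic one from an arbitrary
   probability space of coin tosses. *)
Record rand_alg (R : realType) (n : nat) := RandAlg {
  coin_disp : measure_display;
  coins : measurableType coin_disp;
  coin_prob : probability coins R;
  alg_of : coins -> det_alg n;
  alg_of_measurable : forall (h : history n) (c : option (bits n)),
    measurable [set w | alg_of w h = c] }.

Arguments alg_of {R n} A w h : rename.

(* Zero error: runs that fail to halt with a correct certificate have
   probability 0, on every outmap. *)
Definition rand_solves (R : realType) n (A : rand_alg R n) : Prop :=
  forall s : outmap n, {ae coin_prob A, forall w, det_solves_on (alg_of A w) s}.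

Definition expected_queries (R : realType) n (A : rand_alg R n)
    (s : outmap n) : \bar R :=
  (\int[coin_prob A]_w queries R (alg_of A w) s)%E.

Definition worst_case_queries (R : realType) n (A : rand_alg R n) : \bar R :=
  \big[maxe/-oo%E]_(s : outmap n) expected_queries A s.

(* [x] is the minimum, attained, over the solving randomized algorithms. *)
Definition is_ttilde (R : realType) (n : nat) (x : \bar R) : Prop :=
  (exists2 A : rand_alg R n, rand_solves A & worst_case_queries A = x) /\
  (forall A : rand_alg R n, rand_solves A -> (x <= worst_case_queries A)%E).

(* Main.v *)
(* Upper bound: from a uniformly random vertex, walk along outgoing edges, except
   that after the first answer the algorithm jumps to the antipodal vertex with
   probability 9/17 (both edges outgoing) or 5/17 (one edge outgoing).  Lower
   bound (Yao's principle): the inputs are the images of three outmaps under the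
   eight automorphisms of the square, with weights 8 : 5 : 4; backward induction
   over the histories shows that every deterministic algorithm needs a weighted
   total of at least 368 queries, against a total weight of 8 * (8 + 5 + 4) = 136,
   and 368 / 136 = 46 / 17. *)
From HB Require Import structures.
Require Import Defs.
From mathcomp Require Import all_boot all_order all_algebra.
From mathcomp Require Import all_classical all_reals all_analysis.
From mathcomp Require Import measurable_realfun.
From mathcomp Require Import zify ring.

Set Implicit Arguments.
Unset Strict Implicit.
Unset Printing Implicit Defensive.

Import Order.TTheory GRing.Theory Num.Theory.

(** * Boolean model of the game on the square *)

Local Open Scope nat_scope.

(* Finite functions do not reduce under [vm_compute]; the finite game is evaluated
   on pairs of booleans instead. *)
Notation code := (bool * bool)%type.
Notation table := (code * code * code * code)%type.

Definition code_xor (u v : code) : code := (u.1 (+) v.1, u.2 (+) v.2).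

Definition codes : seq code :=
  [:: (false, false); (true, false); (false, true); (true, true)].

Definition lookup (t : table) (u : code) : code :=
  let: (a, b, c, d) := t in
  match u with
  | (false, false) => a
  | (true, false) => b
  | (false, true) => c
  | (true, true) => d
  end.

Definition tabulate (f : code -> code) : table :=
  (f (false, false), f (true, false), f (false, true), f (true, true)).

Definition code_clash (p q : code * code) : bool :=
  let d := code_xor p.1 q.1 in
  let e := code_xor p.2 q.2 in
  [&& d != (false, false), ~~ (e.1 && d.1) & ~~ (e.2 && d.2)].

(** The recorded answers suffice to recognise a certificate. A pair is also compared with itself,
    harmlessly, since [code_clash] demands distinct vertices. *)
Definition solved (h : seq (code * code)) : bool :=
  has (fun p => (p.2 == (false, false)) || has (code_clash p) h) h.

Fixpoint code_run (a : seq (code * code) -> option code) (t : table) (k : nat) :=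
  if k is k'.+1 then
    let h := code_run a t k' in
    if a h is Some u then rcons h (u, lookup t u) else h
  else [::].

Lemma mem_codes (u : code) : u \in codes.
Proof. by case: u => [[] []]. Qed.

Lemma all_codes (P : pred code) : all P codes -> forall c, P c.
Proof. by move=> /allP + c; apply; exact: mem_codes. Qed.

Lemma lookup_tabulate f u : lookup (tabulate f) u = f u.
Proof. by case: u => [[] []]. Qed.

Definition answers (t : table) (Q : seq code) := [seq (u, lookup t u) | u <- Q].

(** Answers can be recovered from the table, so a game state need only keep the queried vertices. *)
Lemma code_run_answers a t k :
  code_run a t k = answers t [seq p.1 | p <- code_run a t k].
Proof.
elim: k => //= k IH; case: (a _) => // u.
by rewrite map_rcons /answers map_rcons -/(answers _ _) -IH.
Qed.

Lemma eq_solved h h' : h =i h' -> solved h = solved h'.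
Proof.
move=> e; rewrite /solved (eq_has_r e); apply: eq_has => p.
by rewrite (eq_has_r e).
Qed.

(** * Backward induction for deterministic algorithms *)

Definition query_values (V : seq code -> seq (nat * table) -> nat)
    (Q : seq code) (L : seq (nat * table)) : seq nat :=
  [seq sumn [seq p.1 | p <- L] +
       sumn [seq V (rcons Q u) [seq p <- L | lookup p.2 u == c] | c <- codes]
  | u <- codes & u \notin Q].

(* Backward induction over the tuple [Q] of queried vertices, against an
   adversary playing the outmap [p.2] with weight [p.1] for [p] in [L]. *)
Fixpoint game_value (n : nat) (Q : seq code) (L : seq (nat * table)) : nat :=
  if all (fun p => solved (answers p.2 Q)) L then 0 else
  if n is n'.+1 then
    let vals := query_values (game_value n') Q L in foldr minn (head 0 vals) vals
  else 0.

(** Order and multiplicity in [Q] are irrelevant; this handles algorithms that repeat a query. *)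
Lemma eq_game_value n Q Q' L : Q =i Q' -> game_value n Q L = game_value n Q' L.
Proof.
elim: n Q Q' L => [|n IH] Q Q' L e /=; first by rewrite !if_same.
rewrite (eq_all (a2 := fun p => solved (answers p.2 Q'))); last first.
  by move=> p; apply: eq_solved; apply: eq_mem_map.
suff -> : query_values (game_value n) Q L = query_values (game_value n) Q' L by [].
rewrite /query_values (@eq_filter _ _ (fun u => u \notin Q')) => [|u]; last by rewrite e.
apply: eq_map => u; congr (_ + sumn _); apply: eq_map => c.
by apply: IH => v; rewrite !mem_rcons !inE e.
Qed.

Lemma foldr_minn_le b s x : x \in s -> foldr minn b s <= x.
Proof.
elim: s => //= y s IH; rewrite inE geq_min => /orP[/eqP->|/IH ->].
  by rewrite leqnn.
by rewrite orbT.
Qed.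

Lemma sumn_partition (f : nat * table -> nat) u L :
  sumn [seq f p | p <- L] =
  sumn [seq sumn [seq f p | p <- L & lookup p.2 u == c] | c <- codes].
Proof.
elim: L => //= p L ->; by case: (lookup p.2 u) => [[] []] /=; lia.
Qed.

Lemma sumn_mapD (T : Type) (f g : T -> nat) s :
  sumn [seq f x + g x | x <- s] = sumn (map f s) + sumn (map g s).
Proof. by elim: s => //= x s ->; lia. Qed.

Lemma leq_sumn_map (T : eqType) (f g : T -> nat) s :
  {in s, forall x, f x <= g x} -> sumn [seq f x | x <- s] <= sumn [seq g x | x <- s].
Proof.
elim: s => //= x s IH H; apply: leq_add; first by apply: H; rewrite inE eqxx.
by apply: IH => y ys; apply: H; rewrite inE ys orbT.
Qed.

Lemma leq_sumn_mapD (T : eqType) (f g k : T -> nat) s :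
  {in s, forall x, f x + g x <= k x} ->
  sumn (map f s) + sumn (map g s) <= sumn (map k s).
Proof. by rewrite -sumn_mapD; exact: leq_sumn_map. Qed.

(** The value is a minimum over fresh queries, or 0 when the game is solved or the fuel [n] is
    spent; hence [n.-1] also covers [n = 0]. *)
Lemma game_value_le_step n Q L u : u \notin Q ->
  game_value n Q L <= sumn [seq p.1 | p <- L] +
    sumn [seq game_value n.-1 (rcons Q u) [seq p <- L | lookup p.2 u == c]
         | c <- codes].
Proof.
move=> uQ; case: n => [|n] /=; case: ifP => // _.
by apply: foldr_minn_le; apply: (map_f (fun u => _)); rewrite mem_filter uQ mem_codes.
Qed.

Lemma game_value_solved n Q L :
  {in L, forall p, solved (answers p.2 Q)} -> game_value n Q L = 0.
Proof. by move=> /allP H; case: n => [|n] /=; rewrite H. Qed.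

(** Invariant of the lower bound: while the inputs in [L] share the history [h], weighted cost so
    far plus value of the remaining game stays below the final weighted cost. Steps [m] and fuel [n]
    are independent, because an algorithm may repeat queries or have halted. *)
Lemma game_value_bound a m j n h L :
    {in L, forall p, code_run a p.2 j = h} ->
    {in L, forall p, a (code_run a p.2 (j + m)) = None} ->
    {in L, forall p, solved (code_run a p.2 (j + m))} ->
  sumn [seq p.1 * size h | p <- L] + game_value n [seq q.1 | q <- h] L <=
  sumn [seq p.1 * size (code_run a p.2 (j + m)) | p <- L].
Proof.
elim: m j n h L => [|m IH] j n h L runL haltL solvedL.
  rewrite addn0 in solvedL *; rewrite game_value_solved ?addn0.
    by apply: leq_sumn_map => p pL; rewrite runL.
  by move=> p pL; rewrite -(runL _ pL) -code_run_answers; exact: solvedL.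
rewrite -addSnnS in haltL solvedL *.
case E: (a h) => [u|]; last first.
  by apply: IH => // p pL /=; rewrite runL // E.
have runS p : p \in L -> code_run a p.2 j.+1 = rcons h (u, lookup p.2 u).
  by move=> pL /=; rewrite runL // E.
have [uh|uh] := boolP (u \in [seq q.1 | q <- h]).
  case: L => [|p0 L'] in runL haltL solvedL runS *.
    by rewrite game_value_solved.
  set L := p0 :: L' in runL haltL solvedL runS *.
  have p0L : p0 \in L by rewrite inE eqxx.
  (* The answer at [u] is already recorded in the common history, so a repeated query does not split
     [L]. *)
  have lookupE p : p \in L -> lookup p.2 u = lookup p0.2 u.
    move=> pL; case/mapP: uh => -[u' x] + /= ux; rewrite -{}ux => uxh.
    have H q : q \in L -> x = lookup q.2 u.
      move=> qL; move: uxh; rewrite -(runL _ qL) code_run_answers.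
      by case/mapP => v _ [-> ->].
    by rewrite -(H p0) // -(H p).
  have runL' : {in L, forall p, code_run a p.2 j.+1 = rcons h (u, lookup p0.2 u)}.
    by move=> p pL; rewrite runS // lookupE.
  apply: leq_trans (IH _ n _ _ runL' haltL solvedL); apply: leq_add.
    by apply: leq_sumn_map => p _; rewrite size_rcons leq_mul.
  rewrite leq_eqVlt; apply/orP; left; apply/eqP; apply: eq_game_value => v.
  by rewrite map_rcons mem_rcons inE /=; case: eqVneq => // ->; rewrite uh.
(* A fresh query charges each input its weight once; then [L] splits by the answer and induction
   applies to each class. *)
apply: leq_trans (leq_add (leqnn _) (game_value_le_step _ _ uh)) _.
rewrite addnA -(sumn_mapD (fun p => p.1 * size h) (fun p => p.1) L).
rewrite [X in X + _ <= _](sumn_partition _ u) [leqRHS](sumn_partition _ u).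
apply: leq_sumn_mapD => c _.
have memL p : p \in [seq p <- L | lookup p.2 u == c] -> p \in L.
  by rewrite mem_filter => /andP[].
have runLc : {in [seq p <- L | lookup p.2 u == c], forall p,
    code_run a p.2 j.+1 = rcons h (u, c)}.
  by move=> p pc; rewrite runS ?memL //; move: pc; rewrite mem_filter => /andP[/eqP->].
have := IH _ n.-1 _ _ runLc (sub_in1 memL haltL) (sub_in1 memL solvedL).
rewrite map_rcons size_rcons; apply: leq_trans; rewrite leq_add2r.
by apply: leq_sumn_map => p _; lia.
Qed.

(** * The hard inputs and the optimal strategy *)

Definition code_swap (u : code) : code := (u.2, u.1).

(* The automorphism of the square that translates by [v], then exchanges the
   two coordinates if [b] holds. *)
Definition relabel (v : code) (b : bool) (t : table) : table :=
  let sw u := if b then code_swap u else u in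
  tabulate (fun u => sw (lookup t (code_xor (sw u) v))).

(** None of the three outmaps has a sink, so a clash must be found: a single edge in the first, the
    two antipodal pairs in the second (a directed 4-cycle), the two edges at [d] in the third.
    Symmetric copies are kept with multiplicity. *)
Definition adversary : seq (nat * table) :=
  let o := (false, false) in let x := (true, false) in
  let y := (false, true) in let d := (true, true) in
  [seq (p.1, relabel q.1 q.2 p.2)
  | p <- [:: (8, (x, x, y, d)); (5, (x, y, y, x)); (4, (x, y, d, d))],
    q <- [seq (v, b) | v <- codes, b <- [:: false; true]]].

Lemma sumn_adversary : sumn [seq p.1 | p <- adversary] = 136.
Proof. by vm_compute. Qed.

Lemma game_value_adversary : game_value 4 [::] adversary = 368.
Proof. by vm_compute. Qed.

(* For [i < 136], [i %% 8] encodes the start and a preferred edge, and [i %/ 8],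
   ranging over 17 values, decides whether to jump.  After a jump, a vertex with
   both edges outgoing is left towards the outneighbour of the start. *)
Definition strategy (i : nat) (h : seq (code * code)) : option code :=
  let start := (odd i, odd i./2) in
  let edge := (odd i./2./2, ~~ odd i./2./2) in
  let d := (true, true) in
  if solved h then None else
  if h is (v, a) :: h' then
    if h' is [::] then
      if i %/ 8 < (if a == d then 9 else 5) then Some (code_xor v d)
      else Some (code_xor v (if a == d then edge else a))
    else
      let: (u, b) := last (v, a) h' in
      Some (if b == d then code_xor v a else code_xor u b)
  else Some start.

Definition strategy_ok (t : table) : bool :=
  all (fun i => let h := code_run (strategy i) t 4 in
                solved h && (strategy i h == None)) (iota 0 136) &&
  (sumn [seq size (code_run (strategy i) t 4) | i <- iota 0 136] <= 368).

Lemma strategy_okT t : strategy_ok t.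
Proof.
(* Quantifying over [codes] four times makes the claim a closed boolean ranging over all 256
   tables. *)
case: t => [[[a b] c] d]; move: d; apply: all_codes; move: c; apply: all_codes.
move: b; apply: all_codes; move: a; apply: all_codes.
by vm_compute.
Qed.

(** Fuel 4 lets every vertex of the square be queried once. *)
Lemma size_code_run_adversary a k :
    {in adversary, forall p, a (code_run a p.2 k) = None} ->
    {in adversary, forall p, solved (code_run a p.2 k)} ->
  368 <= sumn [seq p.1 * size (code_run a p.2 k) | p <- adversary].
Proof.
move=> haltL solvedL; rewrite -game_value_adversary.
apply: leq_trans (@game_value_bound a k 0 4 [::] adversary _ haltL solvedL) => //.
Qed.

(** * Translation between outmaps and tables *)

Definition encode (u : bits 2) : code := (u ord0, u ord_max).
Definition decode (c : code) : bits 2 := [ffun i => if i == ord0 then c.1 else c.2].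

Lemma encodeK : cancel encode decode.
Proof.
move=> u; apply/ffunP => i; rewrite ffunE /=; case: eqVneq => [-> //|].
by case: i => [[|[|//]] lti] // _ /=; congr (u _); exact: val_inj.
Qed.

Lemma decodeK : cancel decode encode.
Proof. by case=> a b; rewrite /encode !ffunE. Qed.

Lemma encode_bits0 : encode (bits0 2) = (false, false).
Proof. by rewrite /encode !ffunE. Qed.

Definition encode_pair (p : bits 2 * bits 2) : code * code := (encode p.1, encode p.2).
Definition decode_pair (p : code * code) : bits 2 * bits 2 := (decode p.1, decode p.2).

Lemma encode_pairK : cancel encode_pair decode_pair.
Proof. by case=> u v; rewrite /decode_pair !encodeK. Qed.

Definition table_of (s : outmap 2) : table := tabulate (fun c => encode (s (decode c))).

Definition outmap_of (t : table) : outmap 2 := [ffun u => decode (lookup t (encode u))].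

Lemma lookup_table_of s u : lookup (table_of s) (encode u) = encode (s u).
Proof. by rewrite lookup_tabulate encodeK. Qed.

Lemma outmap_ofK t : table_of (outmap_of t) = t.
Proof. by case: t => [[[a b] c] d]; rewrite /table_of /tabulate !ffunE !decodeK. Qed.

Definition code_alg (a : det_alg 2) (h : seq (code * code)) : option code :=
  omap encode (a (map decode_pair h)).

Definition alg_of_code (a : seq (code * code) -> option code) : det_alg 2 :=
  fun h => omap decode (a (map encode_pair h)).

Lemma alg_of_codeK a : code_alg (alg_of_code a) =1 a.
Proof.
move=> h; rewrite /code_alg /alg_of_code -map_comp map_id_in => [|[u v] _ /=].
  by case: (a h) => //= u; rewrite decodeK.
by rewrite /encode_pair /= !decodeK.
Qed.

Lemma eq_code_run a b t : a =1 b -> code_run a t =1 code_run b t.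
Proof. by move=> e; elim=> //= k ->; rewrite e. Qed.

Lemma code_algE a h : code_alg a (map encode_pair h) = omap encode (a h).
Proof. by rewrite /code_alg (mapK encode_pairK). Qed.

Lemma map_encode_run a s k :
  map encode_pair (run a s k) = code_run (code_alg a) (table_of s) k.
Proof.
elim: k => //= k <-; rewrite code_algE; case: (a _) => [u|//].
by rewrite map_rcons; congr (rcons _ (_, _)); exact: (esym (lookup_table_of s u)).
Qed.

Lemma runE n (a : det_alg n) s k : run a s k = [seq (u, s u) | u <- map fst (run a s k)].
Proof. by elim: k => //= k IH; case: (a _) => // u; rewrite !map_rcons -IH. Qed.

Lemma clashP (s : outmap 2) u v :
  reflect (clash s u v) (code_clash (encode_pair (u, s u)) (encode_pair (v, s v))).
Proof.
rewrite /code_clash /=; apply: (iffP and3P) => [[uv c1 c2]|[uv /ffunP c]].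
  split; first by move=> e; move: uv; rewrite e /code_xor /= !addbb eqxx.
  apply: (can_inj encodeK); rewrite encode_bits0 /encode !ffunE.
  by rewrite (negbTE c1) (negbTE c2).
split; last 2 first.
- by have := c ord0; rewrite !ffunE /= => ->.
- by have := c ord_max; rewrite !ffunE /= => ->.
apply/eqP => e; apply: uv; apply: (can_inj encodeK); move: e.
rewrite /code_xor /encode /=.
by move: (u ord0) (v ord0) (u ord_max) (v ord_max) => [] [] [] [].
Qed.

Lemma sink_or_clashP a s k :
  reflect (sink_or_clash s (run a s k)) (solved (map encode_pair (run a s k))).
Proof.
have memQ u : queried (run a s k) u <-> (u, s u) \in run a s k.
  rewrite /queried; split; last by move=> /(map_f fst).
  by rewrite [in X in X -> _]runE -map_comp map_id => uQ; rewrite runE map_f.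
have memR p : p \in run a s k -> p = (p.1, s p.1).
  by rewrite runE => /mapP[u _ ->].
apply: (iffP hasP) => [[_ /mapP[p pr ->] /orP[/eqP p0|/hasP[_ /mapP[q qr ->] pq]]]|].
- left; exists p.1; first by apply/memQ; rewrite -memR.
  by rewrite -[LHS]encodeK -[RHS]encodeK encode_bits0; move: p0; rewrite (memR p pr) /= => ->.
- right; exists p.1, q.1; split; [apply/memQ; by rewrite -memR..|].
  by apply/clashP; rewrite -!memR.
- case=> [[u /memQ us su0]|[u [v [/memQ us /memQ vs /clashP uv]]]].
    by exists (encode_pair (u, s u)); [exact: map_f|rewrite /= su0 encode_bits0 eqxx].
  exists (encode_pair (u, s u)); first exact: map_f.
  by apply/orP; right; apply/hasP; exists (encode_pair (v, s v)) => //; exact: map_f.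
Qed.

(** * Query counts of halted runs *)

Lemma run_stationary n (a : det_alg n) s k m :
  a (run a s k) = None -> run a s (k + m) = run a s k.
Proof. by move=> ak; elim: m => [|m IH]; rewrite ?addn0 // addnS /= IH ak. Qed.

Lemma size_run_homo n (a : det_alg n) s :
  {homo (fun k => size (run a s k)) : k m / k <= m}.
Proof.
apply: homo_leq => // [m k p|k /=]; first exact: leq_trans.
by case: (a _) => // u; rewrite size_rcons.
Qed.

Local Open Scope classical_set_scope.
Local Open Scope ring_scope.

Lemma queries_halt (R : realType) n (a : det_alg n) s k :
  a (run a s k) = None -> queries R a s = (size (run a s k))%:R%:E.
Proof.
move=> ak; apply/eqP; rewrite eq_le; apply/andP; split; last first.
  by apply: ereal_sup_ubound; exists k.
apply: ge_ereal_sup => _ [m _ <-]; rewrite lee_fin ler_nat -(run_stationary m ak).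
by apply: size_run_homo; exact: leq_addl.
Qed.

Lemma le_queries (R : realType) n (a : det_alg n) s k :
  ((size (run a s k))%:R%:E <= queries R a s)%E.
Proof. by apply: ereal_sup_ubound; exists k. Qed.

Lemma queries_ge0 (R : realType) n (a : det_alg n) s : (0 <= queries R a s)%E.
Proof. exact: le_trans (le_queries R a s 0). Qed.

(** * Measurability of the number of queries *)

Section measurability.
Context {d} {T : measurableType d} {R : realType}.

Lemma measurable_const_prop (P : Prop) : measurable [set _ : T | P].
Proof.
have [HP|HP] := pselect P; first by rewrite (_ : [set _ | _] = setT) //; apply/seteqP; split.
by rewrite (_ : [set _ | _] = set0) //; apply/seteqP; split.
Qed.

Lemma measurable_preimage_countable (U : countType) (X : T -> U) (B : set U) :
  (forall u, measurable (X @^-1` [set u])) -> measurable (X @^-1` B).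
Proof.
move=> mX; rewrite [X in measurable X](_ : _ = \bigcup_u (X @^-1` [set u] `&` [set _ | B u])).
  apply: countable_bigcupT_measurable => [|u]; first exact: countableP.
  by apply: measurableI => //; exact: measurable_const_prop.
by apply/seteqP; split => [w Bw|w [u _ [/= -> //]]]; exists (X w).
Qed.

Variables (n : nat) (a : T -> det_alg n) (s : outmap n).
Hypothesis ma : forall h c, measurable [set w | a w h = c].

(** Histories form a countable type, so the event is a countable union over the history one step
    earlier. *)
Lemma measurable_run k h : measurable [set w | run (a w) s k = h].
Proof.
elim: k h => [|k IH] h; first exact: (measurable_const_prop ([::] = h)).
pose step (h' : history n) c := if c is Some u then rcons h' (u, s u) else h'.
rewrite [X in measurable X](_ : _ = \bigcup_h' ([set w | run (a w) s k = h'] `&`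
    (a ^~ h') @^-1` [set c | step h' c = h])).
  apply: countable_bigcupT_measurable => [|h']; first exact: countableP.
  by apply: measurableI; [exact: IH|apply: measurable_preimage_countable; exact: ma].
by apply/seteqP; split => [w rw|w [h' _ [/= -> //]]]; exists (run (a w) s k).
Qed.

Lemma measurable_queries : measurable_fun setT (fun w => queries R (a w) s).
Proof.
(* Here [esups _ 0] is the supremum over all indices, and suprema of sequences preserve
   measurability. *)
have -> : (fun w => queries R (a w) s) =
    fun w => esups (fun k => (size (run (a w) s k))%:R%:E) 0.
  by apply/funext => w; congr ereal_sup; apply/seteqP; split => _ [k _ <-]; exists k.
apply: measurable_fun_esups => k _ B _; rewrite setTI.
apply: (@measurable_preimage_countable (history n) (fun w => run (a w) s k)
  [set h | B (size h)%:R%:E]) => h; exact: measurable_run.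
Qed.

End measurability.

(** * Uniform coin tosses *)

Section uniform.
Context {R : realType} (N : nat).

(** Equal point masses at [0, ..., N]; the 136 seeds correspond to [N = 135]. *)
Definition uniform_nat : set nat -> \bar R :=
  msum (fun k => mscale (((N.+1)%:R : R)^-1)%:nng \d_k) N.+1.

HB.instance Definition _ := Measure.on uniform_nat.

Lemma integral_uniform_nat (f : nat -> \bar R) : (forall x, 0 <= f x)%E ->
  (\int[uniform_nat]_x f x = ((N.+1)%:R : R)^-1%:E * \sum_(k < N.+1) f k)%E.
Proof.
move=> f0; rewrite ge0_integral_measure_sum // ge0_sume_distrr //.
apply: eq_bigr => i _.
by rewrite ge0_integral_mscale //= integral_dirac // diracT mul1e.
Qed.

Let uniform_nat_setT : uniform_nat setT = 1%E.
Proof.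
rewrite /uniform_nat /msum /=; under eq_bigr do rewrite /mscale /= diracT mule1.
by rewrite sumEFin sumr_const card_ord -mulr_natl divff // pnatr_eq0.
Qed.

HB.instance Definition _ :=
  @Measure_isProbability.Build _ _ R uniform_nat uniform_nat_setT.

End uniform.

(** * Upper bound *)

Definition coin_alg (i : nat) : det_alg 2 := alg_of_code (strategy (i %% 136)).

Lemma measurable_coin_alg (h : history 2) (c : option (bits 2)) :
  measurable [set i : nat | coin_alg i h = c].
Proof. by []. Qed.

Definition optimal_alg (R : realType) : rand_alg R 2 :=
  @RandAlg R 2 _ nat (@uniform_nat R 135) coin_alg measurable_coin_alg.

(** Reduction modulo 136 makes every natural number a valid seed, so success holds for all coins and
    not just almost all. *)
Lemma coin_alg_run i s :
  let h := code_run (strategy (i %% 136)) (table_of s) 4 in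
  [/\ coin_alg i (run (coin_alg i) s 4) = None, sink_or_clash s (run (coin_alg i) s 4)
    & size (run (coin_alg i) s 4) = size h].
Proof.
have E : map encode_pair (run (coin_alg i) s 4) =
    code_run (strategy (i %% 136)) (table_of s) 4.
  by rewrite map_encode_run; apply: eq_code_run; exact: alg_of_codeK.
have /andP[/allP/(_ (i %% 136)%N) + _] := strategy_okT (table_of s).
rewrite mem_iota ltn_mod => /(_ isT)/andP[sh /eqP ah].
split; first by rewrite /coin_alg /alg_of_code -/(coin_alg i) E ah.
  by apply/sink_or_clashP; rewrite E.
by rewrite -E size_map.
Qed.

Lemma optimal_alg_solves (R : realType) : rand_solves (optimal_alg R).
Proof.
by move=> s; apply: nearW => i; exists 4%N; have [] := coin_alg_run i s.
Qed.

Lemma expected_queries_optimal_alg (R : realType) s :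
  (expected_queries (optimal_alg R) s <= (46 / 17 : R)%:E)%E.
Proof.
have sizeE i : queries R (coin_alg i) s =
    (size (code_run (strategy (i %% 136)) (table_of s) 4))%:R%:E.
  by have [h _ <-] := coin_alg_run i s; exact: queries_halt.
rewrite /expected_queries /= integral_uniform_nat; last by move=> i; exact: queries_ge0.
rewrite lee_pdivrMl ?ltr0n //; under eq_bigr do rewrite sizeE.
rewrite sumEFin -EFinM lee_fin.
have /andP[_] := strategy_okT (table_of s).
rewrite -(ler_nat R) => /(le_trans _) H.
rewrite (_ : 136%:R * (46 / 17) = 368%:R :> R); last by field.
apply: H; rewrite sumnE big_map -natr_sum ler_nat -[iota 0 136]/(index_iota 0 136) big_mkord.
by apply: leq_sum => i _; rewrite modn_small.
Qed.

(** * Lower bound by averaging over the adversary *)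

Lemma adversary_queries (R : realType) (a : det_alg 2) : (forall s, det_solves_on a s) ->
  (368%:R%:E <= \sum_(p <- adversary) p.1%:R%:E * queries R a (outmap_of p.2))%E.
Proof.
(* The adversary is a finite list and runs are stationary after halting, so one [k] serves all its
   inputs. *)
move=> sol; have [k haltk] : exists k, {in adversary, forall p,
    a (run a (outmap_of p.2) k) = None /\
    sink_or_clash (outmap_of p.2) (run a (outmap_of p.2) k)}.
  elim: adversary => [|p L [k IH]]; first by exists 0%N.
  have [m [am sm]] := sol (outmap_of p.2).
  exists (m + k)%N => q; rewrite inE => /predU1P[->|qL].
    by rewrite run_stationary.
  by have [ak sk] := IH _ qL; rewrite addnC run_stationary.
have runk p : map encode_pair (run a (outmap_of p.2) k) = code_run (code_alg a) p.2 k.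
  by rewrite map_encode_run outmap_ofK.
have haltC : {in adversary, forall p, code_alg a (code_run (code_alg a) p.2 k) = None}.
  by move=> p pL; rewrite -runk code_algE (haltk p pL).1.
have solvedC : {in adversary, forall p, solved (code_run (code_alg a) p.2 k)}.
  by move=> p pL; rewrite -runk; apply/sink_or_clashP; exact: (haltk p pL).2.
have := size_code_run_adversary haltC solvedC.
rewrite -(ler_nat R) -lee_fin => /le_trans; apply.
rewrite sumnE big_map natr_sum -sumEFin; apply: lee_sum => p _.
by rewrite -runk size_map natrM EFinM lee_wpmul2l ?lee_fin // le_queries.
Qed.

(** By linearity, the weighted sum of expectations is the expectation of the weighted sum [Q], which
    is almost surely at least 368. *)
Lemma worst_case_queries_ge (R : realType) (A : rand_alg R 2) :
  rand_solves A -> ((46 / 17 : R)%:E <= worst_case_queries A)%E.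
Proof.
move=> sol; set M := worst_case_queries A.
have leM s : (expected_queries A s <= M)%E by exact: le_bigmax.
have mq s : measurable_fun setT (fun w => queries R (alg_of A w) s).
  by apply: measurable_queries; exact: alg_of_measurable.
pose Q w := (\sum_(p <- adversary) p.1%:R%:E * queries R (alg_of A w) (outmap_of p.2))%E.
have intQ : (\int[coin_prob A]_w Q w =
    \sum_(p <- adversary) p.1%:R%:E * expected_queries A (outmap_of p.2))%E.
  rewrite ge0_integral_sum //; last 2 first.
  - by move=> p; apply: measurable_funeM.
  - by move=> p w _; rewrite mule_ge0 ?queries_ge0 // lee_fin.
  by apply: eq_bigr => p _; rewrite ge0_integralZl_EFin // => w _; exact: queries_ge0.
have : (368%:R%:E <= \int[coin_prob A]_w Q w)%E.
  rewrite -[leLHS]mule1 -(@probability_setT _ _ _ (coin_prob A)) -integral_cst //.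
  apply: ae_ge0_le_integral => //.
  - by move=> w _; rewrite lee_fin ler0n.
  - by move=> w _; apply: sume_ge0 => p _; rewrite mule_ge0 ?queries_ge0 // lee_fin.
  - by apply: emeasurable_sum => p; apply: measurable_funeM.
  have : \forall w \ae coin_prob A, forall s, det_solves_on (alg_of A w) s.
    (* There are finitely many outmaps, so their exceptional null sets combine into one. *)
    by apply: filter_forall => s; exact: sol.
  by apply: filterS => w sw _; exact: adversary_queries.
rewrite intQ => /le_trans H.
have {H} : (368%:R%:E <= \sum_(p <- adversary) p.1%:R%:E * M)%E.
  by apply: H; apply: lee_sum => p _; rewrite lee_wpmul2l ?lee_fin.
rewrite -ge0_sume_distrl; last by move=> p _; rewrite lee_fin.
rewrite sumEFin -natr_sum -(big_map fst xpredT id) -sumnE sumn_adversary.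
rewrite -lee_pdivrMl ?ltr0n // -EFinM.
by rewrite (_ : 136%:R^-1 * 368%:R = 46 / 17 :> R) //; field.
Qed.

Theorem lemma29 (R : realType) : is_ttilde 2 ((46 / 17 : R)%:E).
Proof.
split; last exact: worst_case_queries_ge.
exists (optimal_alg R); first exact: optimal_alg_solves.
apply/eqP; rewrite eq_le worst_case_queries_ge ?andbT; last exact: optimal_alg_solves.
apply: bigmax_le => [|s _]; first exact: leNye.
exact: expected_queries_optimal_alg.
Qed.
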